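(* Let $A:\mathfrak g\times\mathfrak g\times\mathfrak g\to S^2(\mathfrak g)$ be a smooth $SO(3)$-invariant function, and let $M=L(\mathfrak g,\mathfrak{su}(2))$. For a frame $\mathcal F=\{e_1,e_2,e_3\}$ of $\mathfrak{su}(2)$ put $\mathcal F_1=\mathcal F$, $\mathcal F_2=\{e_2,e_3,e_1\}$, $\mathcal F_3=\{e_3,e_1,e_2\}$. Then $$\Pi=\pi_{\mathcal F_1}e_1+\pi_{\mathcal F_2}e_2+\pi_{\mathcal F_3}e_3$$ does not depend on the choice of frame $\mathcal F$ among frames of the same orientation, and is therefore a well-defined section of the vector bundle $\wedge^2TM\otimes\mathfrak{su}(2)$.
   Context: $\mathfrak g$ is a compact semisimple Lie algebra with Killing form $\langle\cdot,\cdot\rangle$, used to identify $\mathfrak g^*$ with $\mathfrak g$. $\mathfrak{su}(2)$ is regarded as an oriented Euclidean vector space (inner product: a positive-definite multiple of the Killing form); a frame is an orthonormal basis $\{e_1,e_2,e_3\}$ of $\mathfrak{su}(2)$. $M=L(\mathfrak g,\mathfrak{su}(2))$ is the space of linear maps $\mathfrak g\to\mathfrak{su}(2)$. A frame $\mathcal F=\{e_1,e_2,e_3\}$ gives an identification $\Psi_{\mathcal F}:M\to\mathfrak g\times\mathfrak g\times\mathfrak g$, $\phi\mapsto(a,b,c)$, where $\phi(x)=\langle a,x\rangle e_1+\langle b,x\rangle e_2+\langle c,x\rangle e_3$. $SO(3)$ acts on $\mathfrak g\times\mathfrak g\times\mathfrak g$ by $(a,b,c)\mapsto(a,b,c)O$.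 $S^2(\mathfrak g)$ is the space of symmetric 2-tensors on $\mathfrak g$, regarded via $\langle\cdot,\cdot\rangle$ as symmetric bilinear forms on $\mathfrak g$; $A_{\xi,\eta}$ denotes the contraction of $A$ with $\xi,\eta\in\mathfrak g$. With $l^1_\xi(a,b,c)=\langle\xi,a\rangle$, $l^2_\xi(a,b,c)=\langle\xi,b\rangle$, $l^3_\xi(a,b,c)=\langle\xi,c\rangle$, $\pi$ is the bivector field on $\mathfrak g\times\mathfrak g\times\mathfrak g$ with bracket $$\{l^1_\xi,l^1_\eta\}=l^1_{[\xi,\eta]},\quad \{l^1_\xi,l^2_\eta\}=\{l^2_\xi,l^1_\eta\}=l^2_{[\xi,\eta]},\quad \{l^2_\xi,l^2_\eta\}=-l^1_{[\xi,\eta]},$$ $$\{l^1_\xi,l^3_\eta\}=\{l^3_\xi,l^1_\eta\}=l^3_{[\xi,\eta]},\quad \{l^3_\xi,l^3_\eta\}=-l^1_{[\xi,\eta]},\quad \{l^2_\xi,l^3_\eta\}=-\{l^3_\xi,l^2_\eta\}=A_{\xi,\eta}.$$ $\pi_{\mathcal F}$ is the bivector field on $M$ corresponding to $\pi$ under $\Psi_{\mathcal F}$. *)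

(* Defs.v *)
From HB Require Import structures.
From mathcomp Require Import all_boot all_order all_algebra.
From mathcomp Require Import all_classical all_reals all_analysis.
From mathcomp Require Import complex lra.
Set Implicit Arguments.
Unset Strict Implicit.
Unset Printing Implicit Defensive.
Import Order.TTheory GRing.Theory Num.Theory.
Import numFieldNormedType.Exports.
Import passmx.
Local Open Scope ring_scope.

Definition dual (R : realType) (V : vectType R) := 'Hom(V, R^o).

Section Smooth.
Context {R : realType}.

Fixpoint Ck {E F : normedModType R} (k : nat) (f : E -> F) : Prop :=
  match k with
  | 0%N => continuous f
  | k'.+1 => (forall x, differentiable f x) /\
             (forall v, Ck k' (fun x => 'D_v f x))
  end.

(* Vector spaces of type vectType carry no topology; smoothness is read in
   linear coordinates. *)
Definition smooth {V W : vectType R} (f : V -> W) : Prop :=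
  forall k, Ck k (rVof (vbasis {:W}) \o f \o vecof (vbasis {:V})).

End Smooth.

Section LieAlgebra.
Context {R : realType} {g : vectType R}.
Implicit Type br : g -> g -> g.

Definition is_lie_bracket (br : {bilinear g -> g -> g}) : Prop :=
  (forall x, br x x = 0) /\
  (forall x y z, br x (br y z) + br y (br z x) + br z (br x y) = 0).

(* The trace of ad x \o ad y. *)
Definition killing br (x y : g) : R :=
  \sum_(i < \dim {:g}) coord (vbasis {:g}) i (br x (br y (vbasis {:g})`_i)).

(* Compact: there is an ad-invariant inner product. Semisimple: no nonzero
   abelian ideal. *)
Definition compact_lie br : Prop :=
  exists B : {biscalar g},
    [/\ forall x y, B x y = B y x,
        forall x, x != 0 -> 0 < B x x &
        forall x y z, B (br x y) z = - B y (br x z)].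

Definition semisimple_lie br : Prop :=
  forall I : {vspace g},
    (forall x y, y \in I -> br x y \in I) ->
    (forall x y, x \in I -> y \in I -> br x y = 0) ->
    I = 0%VS.

(* sharp is the inverse of flat when the Killing form is nondegenerate; see
   flatK. *)
Definition flat br : 'Hom(g, dual g) :=
  linfun (fun xi => linfun (fun x => killing br xi x : R^o) : dual g).

Definition sharp br : 'Hom(dual g, g) := ((flat br)^-1)%VF.

End LieAlgebra.

Section SU2.
Context {R : realType}.
Local Notation C := (R[i]).
Local Notation adjmx A := (map_mx conjc A^T).

Definition su2_pred : pred 'M[C]_2 :=
  fun X => (adjmx X == - X) && (\tr X == 0).

Record su2 := Su2 { su2_val :> 'M[C]_2; su2P : su2_pred su2_val }.

HB.instance Definition _ := [isSub for su2_val].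
HB.instance Definition _ := [Choice of su2 by <:].

Lemma su2_zmod_closed : zmod_closed su2_pred.
Proof.
have mapB (X Y : 'M[C]_2) : adjmx (X - Y) = adjmx X - adjmx Y.
  by apply/matrixP => i j; rewrite !mxE rmorphB.
split.
  rewrite unfold_in /su2_pred mxtrace0 oppr0 eqxx andbT.
  by apply/eqP/matrixP => i j; rewrite !mxE rmorph0.
move=> X Y; rewrite !unfold_in => /andP[/eqP X1 /eqP X2] /andP[/eqP Y1 /eqP Y2].
have trB : \tr (X - Y) = \tr X - \tr Y := raddfB _ X Y.
rewrite /su2_pred mapB X1 Y1 trB X2 Y2 subr0 eqxx andbT.
by rewrite opprB opprK addrC.
Qed.

HB.instance Definition _ :=
  GRing.isZmodClosed.Build _ su2_pred su2_zmod_closed.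
HB.instance Definition _ := [SubChoice_isSubZmodule of su2 by <:].

Lemma su2_scale_subproof (a : R) (X : su2) : su2_pred (a%:C%C *: su2_val X).
Proof.
case: X => X /= /andP[/eqP X1 /eqP X2].
rewrite /su2_pred mxtraceZ X2 mulr0 eqxx andbT -scalerN -X1.
by apply/eqP/matrixP => i j; rewrite !mxE rmorphM /= oppr0.
Qed.

Definition su2_scale a X := Su2 (su2_scale_subproof a X).

Fact su2_scaleA a b X : su2_scale a (su2_scale b X) = su2_scale (a * b) X.
Proof. by apply: val_inj; rewrite /= scalerA rmorphM. Qed.
Fact su2_scale1 : left_id 1 su2_scale.
Proof. by move=> X; apply: val_inj; rewrite /= rmorph1 scale1r. Qed.
Fact su2_scaleDr : right_distributive su2_scale +%R.
Proof. by move=> a X Y; apply: val_inj; rewrite /= scalerDr. Qed.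
Fact su2_scaleDl X : {morph su2_scale^~ X : a b / a + b}.
Proof. by move=> a b; apply: val_inj; rewrite /= rmorphD scalerDl. Qed.

HB.instance Definition _ := GRing.Zmodule_isLmodule.Build R su2
  su2_scaleA su2_scale1 su2_scaleDr su2_scaleDl.

Definition su2_coord (X : su2) : 'rV[R]_3 :=
  \row_j [:: complex.Im (X 0 0); complex.Re (X 0 1); complex.Im (X 0 1)]`_j.

Definition su2_mx (v : 'rV[R]_3) : 'M[C]_2 :=
  \matrix_(i, j)
    if i == 0 then if j == 0 then (0 +i* v 0 0)%C else (v 0 1 +i* v 0 2)%C
    else if j == 0 then (- v 0 1 +i* v 0 2)%C else (0 -i* v 0 0)%C.

Lemma su2_mx_subproof v : su2_pred (su2_mx v).
Proof.
apply/andP; split.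
  apply/eqP/matrixP => -[[|[|//]] ?] [[|[|//]] ?];
  by rewrite !mxE /=; apply/eqP; rewrite eq_complex /= ?oppr0 ?opprK !eqxx.
by rewrite /mxtrace !big_ord_recl big_ord0 !mxE /= addr0; apply/eqP;
  apply/eqP; rewrite eq_complex /= addr0 subrr !eqxx.
Qed.

Fact su2_coord_linear : linear su2_coord.
Proof.
move=> a X Y; apply/rowP => -[[|[|[|//]]] ?]; rewrite !mxE /= ?mxE /=;
by case: (X 0 0) (X 0 1) (Y 0 0) (Y 0 1) => [? ?] [? ?] [? ?] [? ?] /=;
  rewrite ?mul0r ?subr0 ?addr0.
Qed.

Fact su2_coord_bij : bijective su2_coord.
Proof.
exists (fun v => Su2 (su2_mx_subproof v)) => [X | v]; last first.
  by apply/rowP => -[[|[|[|//]]] ?]; rewrite !mxE /= ?mxE /=; congr (v _ _);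
    apply: val_inj.
apply: val_inj; case: X => X XP /=; case/andP: (XP) => /eqP/matrixP X1 /eqP.
rewrite /mxtrace !big_ord_recl big_ord0 addr0.
have -> : lift ord0 ord0 = 1 :> 'I_2 by apply: val_inj.
have := (X1 0 0, X1 1 0); rewrite !mxE => -[].
rewrite (_ : @ord0 1 = 0)//.
move E00: (X 0 0) => [a b]; move E01: (X 0 1) => [c d].
move E10: (X 1 0) => [c' d']; move E11: (X 1 1) => [a' b'] /= [ha] [hc hd] [].
have {}ha : a = 0 by lra.
rewrite ha add0r => ha' hb'; apply/matrixP => i j; rewrite !mxE /=.
have I2 (k : 'I_2) : k = 0 \/ k = 1.
  by case: k => -[|[|//]] k2; [left | right]; apply: val_inj.
have hc' : c' = - c by lra.
have hd' : d' = d by lra.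
have hb : b' = - b by lra.
by case: (I2 i) => ->; case: (I2 j) => -> /=;
  rewrite ?E00 ?E01 ?E10 ?E11 /= ?ha ?ha' ?hc' ?hd' ?hb.
Qed.

HB.instance Definition _ := Lmodule_hasFinDim.Build R su2
  (exist2 _ _ _ su2_coord_linear su2_coord_bij).

End SU2.

Arguments su2 R : clear implicits.

Section OrientedEuclideanSU2.
Context {R : realType}.

Fact su2_bracket_subproof (X Y : su2 R) :
  su2_pred (su2_val X *m su2_val Y - su2_val Y *m su2_val X).
Proof.
case: X Y => X XP [Y YP] /=.
case/andP: (XP) => /eqP X1 /eqP X2; case/andP: (YP) => /eqP Y1 /eqP Y2.
apply/andP; split; last by rewrite [\tr _]raddfB /= mxtrace_mulC subrr.
rewrite linearB /= map_mxB !trmx_mul !map_mxM /= X1 Y1.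
by rewrite !mulNmx !mulmxN !opprK opprB.
Qed.

Definition su2_bracket X Y := Su2 (su2_bracket_subproof X Y).

Definition su2_ip (lam : R) (X Y : su2 R) : R := lam * killing su2_bracket X Y.

Definition frame (lam : R) (F : 3.-tuple (su2 R)) : Prop :=
  basis_of {:su2 R} F /\
  forall i j, su2_ip lam (tnth F i) (tnth F j) = (i == j)%:R.

Definition same_orientation (F F' : 3.-tuple (su2 R)) : Prop :=
  0 < \det (\matrix_(i < 3, j < 3) coord F j (tnth F' i)).

End OrientedEuclideanSU2.

(* Bivectors with values in W: wedge^2 V (x) W is the space of alternating
   bilinear maps on the dual of V with values in W, as dim V is finite; the
   tangent space of V at each of its points is V. *)
Section Bivector.
Context {R : realType} {V W : vectType R}.

Definition bivector_field := V -> dual V -> dual V -> W.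

Definition is_smooth_section (P : bivector_field) : Prop :=
  [/\ forall p b, linear (fun a => P p a b),
      forall p a, linear (P p a),
      forall p a, P p a a = 0 &
      forall a b, smooth (fun p => P p a b)].

End Bivector.
Arguments bivector_field {R} V W.

Section Tensor.
Context {R : realType} {g : vectType R}.
Local Notation g3 := (g * g * g)%type.
Local Notation M := 'Hom(g, su2 R).

(* Symmetric 2-tensors on g, as symmetric bilinear forms. *)
Record S2 := MkS2 {
  S2_form :> {biscalar g};
  S2_sym : forall xi eta, S2_form xi eta = S2_form eta xi }.

Definition comp3 (p : g3) : 'I_3 -> g := tnth [tuple p.1.1; p.1.2; p.2].

Definition act3 (p : g3) (O : 'M[R]_3) : g3 :=
  (\sum_i O i 0 *: comp3 p i, \sum_i O i 1 *: comp3 p i,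
   \sum_i O i 2 *: comp3 p i).

Definition SO3 (O : 'M[R]_3) : Prop := O *m O^T = 1%:M /\ \det O = 1.

Definition SO3_invariant (A : g3 -> S2) : Prop :=
  forall O, SO3 O -> forall p xi eta, A (act3 p O) xi eta = A p xi eta.

Variables (br : g -> g -> g).

Definition l (i : 'I_3) (xi : g) : dual g3 :=
  linfun (fun p : g3 => killing br xi (comp3 p i) : R^o).

(* The bracket of l i xi and l j eta at p; indices start at 0. *)
Definition pi_bracket (A : g3 -> S2) (p : g3) (i j : 'I_3) (xi eta : g) : R :=
  match nat_of_ord i, nat_of_ord j with
  | 0, 0 => l 0 (br xi eta) p
  | 0, 1 | 1, 0 => l 1 (br xi eta) p
  | 1, 1 => - l 0 (br xi eta) p
  | 0, 2 | 2, 0 => l 2 (br xi eta) p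
  | 2, 2 => - l 0 (br xi eta) p
  | 1, 2 => A p xi eta
  | _, _ => - A p xi eta
  end.

Definition incl3 (i : 'I_3) (x : g) : g3 :=
  (if i == 0 then x else 0, if i == 1 then x else 0, if i == 2 then x else 0).

(* The xi_i in the decomposition alpha = \sum_i l i xi_i; see
   covector_compE. *)
Definition covector_comp (alpha : dual g3) (i : 'I_3) : g :=
  sharp br (linfun (fun x => alpha (incl3 i x)) : dual g).

(* The bilinear extension of pi_bracket to all covectors; see pi_g3_l. *)
Definition pi_g3 (A : g3 -> S2) : bivector_field g3 R^o := fun p alpha beta =>
  \sum_i \sum_j
    pi_bracket A p i j (covector_comp alpha i) (covector_comp beta j).

Definition Psi_inv (F : 3.-tuple (su2 R)) : 'Hom(g3, M) :=
  linfun (fun p : g3 =>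
    linfun (fun x : g => \sum_i killing br (comp3 p i) x *: tnth F i) : M).

(* See PsiK and Psi_invK. *)
Definition Psi (F : 3.-tuple (su2 R)) : 'Hom(M, g3) := ((Psi_inv F)^-1)%VF.

Definition pi_frame (A : g3 -> S2) (F : 3.-tuple (su2 R)) :
    bivector_field M R^o := fun phi alpha beta =>
  pi_g3 A (Psi F phi) (alpha \o Psi_inv F)%VF (beta \o Psi_inv F)%VF.

(* [tuple of rot i F] is {e_(i+1), e_(i+2), e_(i+3)}, indices modulo 3. *)
Definition Pi (A : g3 -> S2) (F : 3.-tuple (su2 R)) :
    bivector_field M (su2 R) := fun phi alpha beta =>
  \sum_(i < 3) pi_frame A [tuple of rot i F] phi alpha beta *: tnth F i.

End Tensor.
Arguments S2 {R} g.

Section Characterizations.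
Context {R : realType} {g : vectType R} (br : {bilinear g -> g -> g}).
Local Notation g3 := (g * g * g)%type.

Lemma killing_linearr x : linear (killing br x : g -> R^o).
Proof.
move=> a y z; rewrite /killing scaler_sumr -big_split; apply: eq_bigr => i _ /=.
by rewrite linearDl linearZl_LR linearDr linearZr /= linearD linearZ.
Qed.

Lemma killing_linearl y : linear (fun x => killing br x y : R^o).
Proof.
move=> a x z; rewrite /killing scaler_sumr -big_split; apply: eq_bigr => i _ /=.
by rewrite linearDl linearZl_LR /= linearD linearZ.
Qed.

Lemma linfunE {V W : vectType R} (f : V -> W) : linear f -> linfun f =1 f.
Proof.
move=> lf x; pose F : {linear V -> W} := HB.pack f (GRing.isLinear.Build _ _ _ _ f lf).
exact: (lfunE F).
Qed.

Lemma flatE xi x : flat br xi x = killing br xi x.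
Proof.
have h y : (linfun (fun x => killing br y x : R^o) : dual g) =1 killing br y.
  exact/linfunE/killing_linearr.
rewrite /flat linfunE ?h// => a y z; apply/lfunP => u.
by rewrite add_lfunE scale_lfunE !h killing_linearl.
Qed.

Definition nondegenerate : Prop :=
  forall x, (forall y, killing br x y = 0) -> x = 0.

Lemma flatK : nondegenerate -> cancel (flat br) (sharp br).
Proof.
move=> nd; apply/lker0_lfunK/eqP; apply/eqP; rewrite -subv0.
apply/subvP => x; rewrite memv_ker memv0 => /eqP x0; apply/eqP/nd => y.
by rewrite -flatE x0 zero_lfunE.
Qed.

Fact comp3_linear i : linear (fun p : g3 => comp3 p i).
Proof. by move=> a p q; case: i => -[|[|[|//]]] ?. Qed.

Lemma lE i xi p : l br i xi p = killing br xi (comp3 p i).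
Proof.
rewrite linfunE// => a q r; rewrite comp3_linear; exact: killing_linearr.
Qed.

Lemma covector_compE i j xi : nondegenerate ->
  covector_comp br (l br i xi) j = if i == j then xi else 0.
Proof.
move=> nd; rewrite -[RHS](flatK nd); congr (sharp br _); apply/lfunP => x.
have h y : l br i xi (incl3 j y) = if i == j then killing br xi y else 0.
  have k0 : killing br xi 0 = 0 by rewrite -flatE linear0.
  by rewrite lE; case: i j => -[|[|[|//]]] ? [[|[|[|//]]] ?].
rewrite linfunE ?flatE; first by rewrite h; case: eqP => // _;
  rewrite -flatE linear0 zero_lfunE.
move=> a y z; rewrite !h; case: eqP => _; first exact: killing_linearr.
by rewrite scaler0 addr0.
Qed.

Lemma pi_g3_l (A : g3 -> S2 g) p i j xi eta : nondegenerate ->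
  pi_g3 br A p (l br i xi) (l br j eta) = pi_bracket br A p i j xi eta.
Proof.
move=> nd; have l0 k : l br k 0 p = 0 by rewrite lE -flatE linear0 zero_lfunE.
have b0l u v x : pi_bracket br A p u v 0 x = 0.
  by rewrite /pi_bracket linear0l !l0 linear0l oppr0; case: u v => -[|[|[|//]]] ? [[|[|[|//]]] ?].
have b0r u v x : pi_bracket br A p u v x 0 = 0.
  by rewrite /pi_bracket linear0r !l0 linear0r oppr0; case: u v => -[|[|[|//]]] ? [[|[|[|//]]] ?].
rewrite /pi_g3 (bigD1 i)//= [X in _ + X]big1 ?addr0; last first.
  move=> k ki; apply: big1 => m _.
  by rewrite covector_compE// eq_sym (negPf ki) b0l.
rewrite (bigD1 j)//= [X in _ + X]big1 ?addr0 ?covector_compE ?eqxx// => k kj.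
by rewrite (covector_compE j)// (eq_sym j) (negPf kj) b0r.
Qed.

Lemma Psi_invE (F : 3.-tuple (su2 R)) p x :
  Psi_inv br F p x = \sum_i killing br (comp3 p i) x *: tnth F i.
Proof.
have h q y : (linfun (fun y : g => \sum_i killing br (comp3 q i) y *: tnth F i)
    : 'Hom(g, su2 R)) y = \sum_i killing br (comp3 q i) y *: tnth F i.
  rewrite linfunE// => a u v; rewrite scaler_sumr -big_split.
  by apply: eq_bigr => i _; rewrite killing_linearr scalerDl scalerA.
rewrite /Psi_inv linfunE ?h// => a q r; apply/lfunP => y.
rewrite add_lfunE scale_lfunE !h scaler_sumr -big_split; apply: eq_bigr => i _.
by rewrite comp3_linear killing_linearl scalerDl scalerA.
Qed.

Lemma Psi_invK (F : 3.-tuple (su2 R)) : nondegenerate -> basis_of {:su2 R} F ->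
  cancel (Psi_inv br F) (Psi br F).
Proof.
move=> nd Fb; apply: lker0_lfunK; rewrite -subv0; apply/subvP => p.
rewrite memv_ker memv0 => /eqP p0.
have z i : comp3 p i = 0.
  apply: nd => y; have /= := congr1 (coord F i) (Psi_invE F p y).
  rewrite p0 zero_lfunE linear0 => /esym.
  rewrite (eq_bigr (fun j : 'I_3 => killing br (comp3 p j) y *: F`_j)).
    by rewrite coord_sum_free// (basis_free Fb).
  by move=> j _; rewrite (tnth_nth 0).
by case: p {p0} z => [[a b] c] z; have := (z 0, z 1, z 2);
  rewrite /comp3 !(tnth_nth 0) /= => -[[-> ->] ->].
Qed.

Lemma PsiK (F : 3.-tuple (su2 R)) : nondegenerate -> basis_of {:su2 R} F ->
  cancel (Psi br F) (Psi_inv br F).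
Proof.
move=> nd Fb phi; apply: limg_lfunVK; suff -> : limg (Psi_inv br F) = fullv.
  exact: memvf.
apply/eqP; rewrite eqEdim subvf limg_dim_eq.
  by rewrite !dimvf /dim /= mulnC !mulSn mul0n addn0 addnA.
have /lker0P/eqP -> := can_inj (Psi_invK nd Fb).
by rewrite capv0.
Qed.

End Characterizations.

(* Main.v *)
Require Import Defs.
From mathcomp Require Import all_boot all_order all_algebra.
From mathcomp Require Import all_classical all_reals all_analysis.
From HB Require Import structures.
From mathcomp Require Import complex ring lra.
Import Order.TTheory GRing.Theory Num.Theory.
Import numFieldNormedType.Exports.
Import passmx.
Local Open Scope ring_scope.
Set Implicit Arguments.
Unset Strict Implicit.
Unset Printing Implicit Defensive.

(** Write xi(e), eta(e), c(e) for the e-components of two covectors and of a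
    point phi; they depend linearly on the vector e of su(2), and their values at
    e_1, e_2, e_3 are the coordinates in the frame. Collecting the brackets of the
    three rotated frames, the value of Pi on the two covectors is
      sum_ij (<c_j,[xi_i,eta_j]> e_i + <c_i,[xi_i,eta_j]> e_j)
        - sum_ik <c_k,[xi_i,eta_i]> e_k + sum_ijk eps_ijk A(xi_i,eta_j) e_k.
    The first three sums are contractions of two indices, hence O(3)-invariant,
    and the last one is a cross product, hence SO(3)-invariant. The Killing form is
    nondegenerate because ad x is skew for an invariant inner product, so that
    tr (ad x)^2 = 0 forces x to be central. *)

(** * Bases and orthonormal bases *)

Section Bases.
Context {K : fieldType} {V : vectType K}.

Lemma coord_basis_tnth n (e : n.-tuple V) (v : V) : basis_of fullv e ->
  v = \sum_i coord e i v *: tnth e i.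
Proof.
move=> eb; rewrite {1}(coord_basis eb (memvf v)).
by apply: eq_bigr => i _; rewrite (tnth_nth 0).
Qed.

Lemma coord_tnth n (e : n.-tuple V) i j : free e ->
  coord e i (tnth e j) = (j == i)%:R.
Proof. by move=> fe; rewrite (tnth_nth 0) coord_free. Qed.

(** Substituting the expansion of [tnth e i] in [e'] gives a double sum of products of coordinates;
    summing over [i] first reassembles [f (tnth e' j)]. The lengths [m] and [n] are kept apart so
    that [vbasis], of length [\dim], can be compared with any tuple. *)
Lemma trace_basis_independent m n (e : m.-tuple V) (e' : n.-tuple V)
    (f : {linear V -> V}) : basis_of fullv e -> basis_of fullv e' ->
  \sum_i coord e i (f (tnth e i)) = \sum_j coord e' j (f (tnth e' j)).
Proof.
move=> eb e'b.
transitivity (\sum_i \sum_j coord e' j (tnth e i) * coord e i (f (tnth e' j))).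
  apply: eq_bigr => i _; rewrite {1}(coord_basis_tnth (tnth e i) e'b) !linear_sum.
  by apply: eq_bigr => j _; rewrite !linearZ.
rewrite exchange_big; apply: eq_bigr => j _ /=.
rewrite [in RHS](coord_basis_tnth (f (tnth e' j)) eb) linear_sum.
by apply: eq_bigr => i _; rewrite linearZ /= mulrC.
Qed.

Lemma basis_change_mul n (e e' e'' : n.-tuple V) : basis_of fullv e' ->
  \matrix_(i, j) coord e j (tnth e'' i) =
  \matrix_(i, j) coord e' j (tnth e'' i) *m
  \matrix_(i, j) coord e j (tnth e' i).
Proof.
move=> e'b; apply/matrixP => i j; rewrite !mxE.
rewrite {1}(coord_basis_tnth (tnth e'' i) e'b) linear_sum.
by apply: eq_bigr => k _; rewrite linearZ /= !mxE.
Qed.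

Lemma det_basis_change_neq0 n (e e' : n.-tuple V) :
  basis_of fullv e -> basis_of fullv e' ->
  \det (\matrix_(i, j) coord e j (tnth e' i)) != 0.
Proof.
move=> eb e'b; have /(congr1 determinant) := basis_change_mul e' e' eb.
rewrite det_mulmx (_ : \matrix_(i, j) _ = 1%:M) ?det1.
  by move=> h; apply/eqP => h0; move/eqP: h; rewrite h0 mul0r oner_eq0.
by apply/matrixP => i j; rewrite !mxE coord_tnth ?(basis_free e'b).
Qed.

End Bases.

Section GramSchmidt.
Context {R : rcfType} {V : vectType R} (B : {biscalar V}).
Hypothesis B_pos : forall x, x != 0 -> 0 < B x x.

Definition orthonormal_tuple n (e : n.-tuple V) :=
  forall i j, B (tnth e i) (tnth e j) = (i == j)%:R.

Lemma orthonormal_coef n (e : n.-tuple V) (k : 'I_n -> R) i : orthonormal_tuple e ->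
  B (tnth e i) (\sum_j k j *: tnth e j) = k i.
Proof.
move=> eo; rewrite linear_sumr (bigD1 i)//= linearZr_LR /= eo eqxx mulr1.
rewrite big1 ?addr0// => j ji.
by rewrite linearZr_LR /= eo eq_sym (negPf ji) mulr0.
Qed.

Lemma orthonormal_tuple_free n (e : n.-tuple V) : orthonormal_tuple e -> free e.
Proof.
move=> eo; apply/freeP => k k0 i.
rewrite -(orthonormal_coef k i eo) (eq_bigr (fun j : 'I_n => k j *: e`_j)).
  by rewrite k0 linear0r.
by move=> j _; rewrite (tnth_nth 0).
Qed.

Hypothesis B_sym : forall x y, B x y = B y x.

(** One Gram-Schmidt step: a vector outside the span, which exists for reasons of dimension, is
    stripped of its projection and normalized. *)
Lemma orthonormal_extend n (e : n.-tuple V) : (n < \dim {:V})%N ->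
  orthonormal_tuple e -> exists e' : n.+1.-tuple V, orthonormal_tuple e'.
Proof.
move=> ndim eo.
have [v ve] : exists v, v \notin <<e>>%VS.
  apply: contrapT => /forallNP h; suff : (fullv <= <<e>>)%VS.
    move/dimvS; rewrite leqNgt => /negP; apply.
    by apply: leq_ltn_trans ndim; rewrite -[leqRHS](size_tuple e) dim_span.
  by apply/subvP => v _; apply/negPn/negP/h.
pose w := v - \sum_j B (tnth e j) v *: tnth e j.
have w0 : w != 0.
  apply: contra ve; rewrite subr_eq0 => /eqP ->.
  by apply: memv_suml => j _; apply/memvZ/memv_span/mem_tnth.
have we i : B (tnth e i) w = 0.
  by rewrite linearBr orthonormal_coef// subrr.
pose u := (Num.sqrt (B w w))^-1 *: w.
have eu i : B (tnth e i) u = 0 by rewrite linearZr_LR /= we mulr0.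
have uu : B u u = 1.
  rewrite linearZl_LR linearZr_LR /= mulrA -invfM -expr2 sqr_sqrtr ?ltW ?B_pos//.
  by rewrite mulVf// gt_eqF ?B_pos.
exists [tuple of u :: e] => i j.
case: (unliftP ord0 i) => [i'|] ->; case: (unliftP ord0 j) => [j'|] ->;
  rewrite ?tnthS ?tnth0 ?(inj_eq lift_inj) ?eo ?eu ?uu //.
by rewrite B_sym eu.
Qed.

Lemma orthonormal_basis_exists n : \dim {:V} = n ->
  exists e : n.-tuple V, basis_of fullv e /\ orthonormal_tuple e.
Proof.
move=> dimV; have h k : (k <= n)%N -> exists e : k.-tuple V, orthonormal_tuple e.
  elim: k => [|k IH] kn; first by exists [tuple] => -[].
  by have [e eo] := IH (ltnW kn); apply: orthonormal_extend eo; rewrite dimV.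
have [e eo] := h n (leqnn n); exists e; split => //.
by rewrite basisEfree (orthonormal_tuple_free eo) subvf size_tuple dimV leqnn.
Qed.

End GramSchmidt.

(** * Rotations of three-dimensional space *)

Lemma ord3_cases (k : 'I_3) : [\/ k = 0, k = 1 | k = 2].
Proof.
case: k => -[|[|[|//]]] k3;
  [constructor 1 | constructor 2 | constructor 3]; exact: val_inj.
Qed.

Lemma big_ord3 (V : nmodType) (F : 'I_3 -> V) : \sum_i F i = F 0 + F 1 + F 2.
Proof.
rewrite !big_ord_recl big_ord0 addr0 addrA.
by congr (F _ + F _ + F _); apply: val_inj.
Qed.

Lemma ord3_add :
  ((0 + 1 = 1 :> 'I_3)%R * (1 + 1 = 2 :> 'I_3)%R * (2 + 1 = 0 :> 'I_3)%R *
   (0 + 2 = 2 :> 'I_3)%R * (1 + 2 = 0 :> 'I_3)%R * (2 + 2 = 1 :> 'I_3)%R)%type.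
Proof. by do !split; apply: val_inj. Qed.

Lemma linear_sumZ (R : pzRingType) (U V : lmodType R) (f : U -> V) (I : Type)
    (r : seq I) (a : I -> R) (u : I -> U) : linear f ->
  f (\sum_(i <- r) a i *: u i) = \sum_(i <- r) a i *: f (u i).
Proof.
move=> fl; have f0 : f 0 = 0 by rewrite -(subrr 0) -scaleN1r addrC fl scaleN1r addNr.
by elim/big_rec2: _ => // i x y _ <-; rewrite fl.
Qed.

Section Rotation.
Context {R : comUnitRingType}.

(** Taking indices cyclically modulo 3 absorbs the sign of the cofactor. *)
Lemma cofactor3 (O : 'M[R]_3) k j :
  cofactor O k j = O (k + 1) (j + 1) * O (k + 2) (j + 2)
                 - O (k + 1) (j + 2) * O (k + 2) (j + 1).
Proof.
rewrite /cofactor (expand_det_row _ 0) !big_ord_recl big_ord0 /cofactor.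
rewrite !det_mx11 !mxE.
have [] := ord3_cases k => ->; have [] := ord3_cases j => ->; rewrite !ord3_add.
(* The expansion writes equal indices in different forms; naming the entries by the numerical values
   of their indices lets [ring] identify them. *)
all: pose o (m n : nat) := O (inord m) (inord n).
all: have E a b : O a b = o a b by rewrite /o !inord_val.
all: by rewrite !{}E /= /bump /= ?expr0 ?expr1 ?expr2; ring.
Qed.

(** The adjugate and the transpose are both the inverse of a rotation. *)
Lemma cofactor_rotation (O : 'M[R]_3) k j : O *m O^T = 1%:M -> \det O = 1 ->
  cofactor O k j = O k j.
Proof.
move=> OO detO; suff : \adj O = O^T by move/matrixP/(_ j k); rewrite !mxE.
by rewrite -[LHS]mul1mx -(mulmx1C OO) -mulmxA mul_mx_adj detO mulmx1.
Qed.

(** After bilinear expansion the coefficient of [f (u j) (v k)] is an entry of [O^T *m O], which is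
    the identity. *)
Lemma contraction_orthogonal (U V W : lmodType R) (f : U -> V -> W) (n : nat)
    (O : 'M[R]_n) (u : 'I_n -> U) (v : 'I_n -> V) :
  (forall y, linear (f^~ y)) -> (forall x, linear (f x)) -> O *m O^T = 1%:M ->
  \sum_i f (\sum_j O i j *: u j) (\sum_j O i j *: v j) = \sum_i f (u i) (v i).
Proof.
move=> fl fr /mulmx1C OO.
transitivity (\sum_i \sum_j \sum_k (O i j * O i k) *: f (u j) (v k)).
  apply: eq_bigr => i _; rewrite (linear_sumZ _ _ _ (fl _)).
  apply: eq_bigr => j _; rewrite (linear_sumZ _ _ _ (fr _)) scaler_sumr.
  by apply: eq_bigr => k _; rewrite scalerA.
rewrite exchange_big; apply: eq_bigr => j _ /=.
have delta k : \sum_i O i j * O i k = (j == k)%:R.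
  have /matrixP/(_ j k) := OO; rewrite !mxE => <-.
  by apply: eq_bigr => i _; rewrite mxE.
rewrite exchange_big (bigD1 j)//= -scaler_suml delta eqxx scale1r big1 ?addr0//.
by move=> k kj; rewrite -scaler_suml delta eq_sym (negPf kj) scale0r.
Qed.

(* The cross product is SO(3)-equivariant because the cofactors of a rotation are
   its entries. *)
Lemma skew_part_rotation (U V : lmodType R) (f : U -> V -> R^o)
    (O : 'M[R]_3) (u : 'I_3 -> U) (v : 'I_3 -> V) (k : 'I_3) :
  (forall y, linear (f^~ y)) -> (forall x, linear (f x)) ->
  O *m O^T = 1%:M -> \det O = 1 ->
  let u' i := \sum_j O i j *: u j in let v' i := \sum_j O i j *: v j in
  f (u' (k + 1)) (v' (k + 2)) - f (u' (k + 2)) (v' (k + 1)) =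
  \sum_j O k j * (f (u (j + 1)) (v (j + 2)) - f (u (j + 2)) (v (j + 1))).
Proof.
move=> fl fr OO detO u' v'.
have fE i j : f (u' i) (v' j) = \sum_a \sum_b O i a * (O j b * f (u a) (v b)).
  rewrite (linear_sumZ _ _ _ (fl _)); apply: eq_bigr => a _.
  by rewrite (linear_sumZ _ _ _ (fr _)) scaler_sumr.
under eq_bigr do rewrite -(cofactor_rotation k _ OO detO) cofactor3.
by rewrite !fE !big_ord3 !ord3_add; ring.
Qed.

End Rotation.

(** * Smoothness and linear maps *)

Section Ck.
Context {R : realType}.
Implicit Types E F G H : normedModType R.

Lemma Ck_cst E F k (c : F) : Ck k (fun _ : E => c).
Proof.
elim: k c => [|k IH] c /=; first exact: cst_continuous.
split=> [x|v]; first exact: differentiable_cst.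
by under eq_fun do rewrite derive_cst.
Qed.

Lemma Ck_linear E F k (f : {linear E -> F}) : continuous f -> Ck k f.
Proof.
move=> fc; case: k => [|k] //=.
have df x : differentiable f x by apply: linear_differentiable.
split=> // v; under eq_fun do rewrite deriveE// diff_lin//.
exact: Ck_cst.
Qed.

Lemma CkD E F k (f g : E -> F) : Ck k f -> Ck k g -> Ck k (f \+ g).
Proof.
elim: k f g => [|k IH] f g /=; first by move=> fc gc x; exact: cvgD (fc x) (gc x).
move=> [df Df] [dg Dg]; split=> [x|v]; first exact: differentiableD.
have -> : (fun x => 'D_v (f \+ g) x) = 'D_v f \+ 'D_v g; last exact: IH.
by apply/funext => x; rewrite deriveD//; apply: diff_derivable.
Qed.

(** The derivative along [v] is [h \o 'D_(g v) f \o g], which has the same shape, so the induction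
    on [k] closes. *)
Lemma Ck_comp_linear E F G H k (h : {linear F -> G}) (f : E -> F)
    (g : {linear H -> E}) : continuous h -> continuous g -> Ck k f ->
  Ck k (h \o f \o g).
Proof.
move=> hc gc; have dg x : differentiable g x by apply: linear_differentiable.
have dh x : differentiable h x by apply: linear_differentiable.
elim: k f => [|k IH] f /=.
  move=> fc x; apply: (continuous_comp (gc x)).
  exact: (continuous_comp (fc (g x)) (hc (f (g x)))).
move=> [df Df]; split=> [x|v].
  by apply: differentiable_comp => //; apply: differentiable_comp.
rewrite (_ : (fun x => _) = h \o (fun x => 'D_(g v) f x) \o g); first exact: IH.
apply/funext => x; have dhf y : differentiable (h \o f) y.
  exact: differentiable_comp.
have dhfg : differentiable (h \o f \o g) x by exact: differentiable_comp.
rewrite (deriveE _ dhfg) (diff_comp (dg x) (dhf (g x))).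
rewrite (diff_comp (df (g x)) (dh (f (g x)))) (diff_lin _ gc) (diff_lin _ hc).
by rewrite /= (deriveE _ (df (g x))).
Qed.

Lemma rV_linear_continuous n F (f : {linear 'rV[R]_n -> F}) : continuous f.
Proof.
rewrite (_ : (f : _ -> _) = fun x : 'rV_n => \sum_j x 0 j *: f (delta_mx 0 j)).
  apply: (continuous_big (op := +%R)) => [|j _ x]; first exact: add_continuous.
  have xj : ((fun y : 'rV[R]_n => y 0 j) y @[y --> x] --> x 0 j)%classic.
    exact: coord_continuous.
  exact: cvgZr_tmp xj.
apply/funext => x; rewrite {1}(row_sum_delta x) linear_sum.
by apply: eq_bigr => j _; rewrite linearZ.
Qed.

End Ck.

Section Smooth.
Context {R : realType}.
Implicit Types V W X Y : vectType R.

Lemma smooth_linear V W (f : {linear V -> W}) : smooth f.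
Proof.
move=> k; pose F : {linear 'rV[R]_(\dim {:V}) -> 'rV[R]_(\dim {:W})} :=
  rVof (vbasis {:W}) \o f \o vecof (vbasis {:V}).
have Fc : continuous F by exact: rV_linear_continuous.
exact: (Ck_linear k Fc).
Qed.

Lemma smoothD V W (f g : V -> W) : smooth f -> smooth g -> smooth (f \+ g).
Proof.
move=> sf sg k; rewrite (_ : _ \o _ = (rVof (vbasis {:W}) \o f \o vecof (vbasis {:V}))
  \+ (rVof (vbasis {:W}) \o g \o vecof (vbasis {:V}))); first exact: CkD.
by apply/funext => x /=; rewrite linearD.
Qed.

Lemma smooth_sum V W (I : Type) (r : seq I) (f : I -> V -> W) :
  (forall i, smooth (f i)) -> smooth (fun x => \sum_(i <- r) f i x).
Proof.
move=> sf; elim: r => [|i r IH].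
  by under eq_fun do rewrite big_nil; apply: (smooth_linear (\0 : {linear V -> W})).
by under eq_fun do rewrite big_cons; apply: smoothD.
Qed.

Lemma smooth_comp_linear V W X Y (h : {linear W -> X}) (f : V -> W)
    (g : {linear Y -> V}) : smooth f -> smooth (h \o f \o g).
Proof.
move=> sf k; pose h' := rVof (vbasis {:X}) \o h \o vecof (vbasis {:W}).
pose g' := rVof (vbasis {:V}) \o g \o vecof (vbasis {:Y}).
(* The coordinate maps inserted between consecutive factors cancel. *)
rewrite (_ : _ \o _ = h' \o (rVof (vbasis {:W}) \o f \o vecof (vbasis {:V})) \o g').
  by apply: Ck_comp_linear; rewrite ?/h' ?/g' //; apply: rV_linear_continuous.
by apply/funext => x; rewrite /h' /g' /= !rVofK// vbasisP.
Qed.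

End Smooth.

(** * Killing forms and frames *)

Section Killing.
Context {R : realType} {g : vectType R} (br : {bilinear g -> g -> g}).

Lemma killing_is_biscalar : bilinear_for *%R *%R (killing br).
Proof.
by split=> [y a x z|x a y z]; rewrite ?(killing_linearl br) ?(killing_linearr br).
Qed.

HB.instance Definition _ := bilinear_isBilinear.Build R g g R *%R *%R (killing br)
  killing_is_biscalar.

Lemma killing_trace n (e : n.-tuple g) x y : basis_of fullv e ->
  killing br x y = \sum_i coord e i (br x (br y (tnth e i))).
Proof.
move=> eb; rewrite -(trace_basis_independent (br x \o br y) (vbasisP _) eb).
by apply: eq_bigr => i _; rewrite (tnth_nth 0).
Qed.

(** This is tr(PQ) = tr(QP): both sides become the same double sum of products of matrix entries. *)
Lemma killing_sym x y : killing br x y = killing br y x.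
Proof.
pose e := vbasis {:g}; have eb : basis_of fullv e by exact: vbasisP.
have h u v : killing br u v =
    \sum_i \sum_j coord e j (br v (tnth e i)) * coord e i (br u (tnth e j)).
  rewrite (killing_trace u v eb); apply: eq_bigr => i _.
  rewrite [in LHS](coord_basis_tnth (br v (tnth e i)) eb) !linear_sum.
  by apply: eq_bigr => j _; rewrite !linearZ.
rewrite !h exchange_big; apply: eq_bigr => j _; apply: eq_bigr => i _.
by rewrite mulrC.
Qed.

Lemma lie_bracketC x y : is_lie_bracket br -> br x y = - br y x.
Proof.
move=> [br0 _]; apply/eqP; rewrite -addr_eq0; have /eqP := br0 (x + y).
by rewrite linearDl !linearDr !br0 add0r addr0.
Qed.

Lemma killing_nondegenerate : is_lie_bracket br -> compact_lie br ->
  semisimple_lie br -> Defs.nondegenerate br.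
Proof.
move=> brL [B [B_sym B_pos B_inv]] brS x Kx0.
have [e [eb eo]] := orthonormal_basis_exists B_pos B_sym (erefl _).
have coefE i v : coord e i v = B (tnth e i) v.
  by rewrite [in RHS](coord_basis_tnth v eb) (orthonormal_coef _ _ eo).
have B_ge0 v : 0 <= B v v.
  by have [->|/B_pos/ltW//] := eqVneq v 0; rewrite linear0l.
(* In a [B]-orthonormal basis, skewness of ad x turns the trace of its square into minus this sum of
   squared lengths, and [Kx0 x] says that this trace is zero. *)
have sum0 : \sum_i B (br x (tnth e i)) (br x (tnth e i)) = 0.
  apply: oppr_inj; rewrite oppr0 -[RHS](Kx0 x) (killing_trace x x eb) -sumrN.
  by apply: eq_bigr => i _; rewrite coefE B_inv opprK.
have bre i : br x (tnth e i) = 0.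
  apply/eqP/negPn/negP => /B_pos; rewrite lt_neqAle eq_sym => /andP[/negP + _].
  by apply; rewrite (psumr_eq0P _ sum0).
have brx y : br x y = 0.
  rewrite (coord_basis_tnth y eb) linear_sum big1// => i _.
  by rewrite linearZ /= bre scaler0.
(* A central [x] spans an abelian ideal, which is zero by semisimplicity. *)
have : <[x]>%VS = 0%VS.
  apply: brS => [y _ /vlineP[k ->]|_ _ /vlineP[k ->] /vlineP[m ->]].
    by rewrite linearZ /= lie_bracketC// brx oppr0 scaler0 mem0v.
  by rewrite linearZl_LR linearZ /= brx !scaler0.
by move/eqP; rewrite -dimv_eq0 dim_vline eqb0 negbK => /eqP.
Qed.

End Killing.

Section SU2Frames.
Context {R : realType}.
Implicit Types (lam : R) (F : 3.-tuple (su2 R)).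

Lemma su2_bracket_is_bilinear :
  bilinear_for *:%R *:%R (@su2_bracket R : su2 R -> su2 R -> su2 R).
Proof.
split=> [Y a X Z|X a Y Z]; apply: val_inj => /=;
by rewrite mulmxDl mulmxDr -scalemxAl -scalemxAr scalerBr opprD addrACA.
Qed.

HB.instance Definition _ := bilinear_isBilinear.Build R _ _ _ *:%R *:%R
  (@su2_bracket R : su2 R -> su2 R -> su2 R) su2_bracket_is_bilinear.

Lemma su2_ip_is_biscalar lam : bilinear_for *%R *%R (su2_ip lam).
Proof.
pose b : {bilinear su2 R -> su2 R -> su2 R} := @su2_bracket R.
split=> [y a x z|x a y z]; rewrite /su2_ip /=.
  by rewrite (killing_linearl b) mulrDr; congr (_ + _); exact: mulrCA.
by rewrite (killing_linearr b) mulrDr; congr (_ + _); exact: mulrCA.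
Qed.

HB.instance Definition _ lam := bilinear_isBilinear.Build R _ _ R *%R *%R
  (su2_ip lam) (su2_ip_is_biscalar lam).

Lemma su2_ip_sym lam X Y : su2_ip lam X Y = su2_ip lam Y X.
Proof. by rewrite /su2_ip killing_sym. Qed.

(** If the orthonormal basis found first has the wrong orientation, negating all three vectors
    corrects it, since the dimension is odd. *)
Lemma frame_exists lam (lam_pos : forall X : su2 R, X != 0 -> 0 < su2_ip lam X X)
    (B : 3.-tuple (su2 R)) : basis_of fullv B ->
  exists F, frame lam F /\ same_orientation B F.
Proof.
move=> Bb; have dim3 : \dim {:su2 R} = 3 by rewrite dimvf.
have [F [Fb Fo]] := orthonormal_basis_exists lam_pos (su2_ip_sym lam) dim3.
have := det_basis_change_neq0 Bb Fb; rewrite neq_lt => /orP[detF|]; last by exists F.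
pose F' := [tuple - tnth F i | i < 3].
have F'E i : tnth F' i = - tnth F i by rewrite tnth_mktuple.
have F'o : orthonormal_tuple (su2_ip lam) F'.
  by move=> i j; rewrite !F'E linearNl linearNr opprK Fo.
exists F'; split.
  split=> //; rewrite basisEfree (orthonormal_tuple_free F'o) subvf dim3.
  by rewrite size_tuple.
rewrite /same_orientation (_ : \matrix_(i, j) _ =
    - \matrix_(i < 3, j < 3) coord B j (tnth F i)).
  by rewrite -scaleN1r detZ -signr_odd /= expr1 mulN1r oppr_gt0.
by apply/matrixP => i j; rewrite !mxE F'E linearN.
Qed.

(** Determinants of base changes multiply, so orientations can be compared through the reference
    basis [B]. *)
Lemma same_orientation_trans (B F F' : 3.-tuple (su2 R)) :
  basis_of fullv F ->
  same_orientation B F -> same_orientation B F' -> same_orientation F F'.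
Proof.
move=> Fb BF; rewrite /same_orientation (basis_change_mul B F' Fb) det_mulmx.
by rewrite pmulr_lgt0.
Qed.

Definition frame_change F F' : 'M[R]_3 := \matrix_(i, j) coord F j (tnth F' i).

Lemma frame_changeE F F' i : basis_of fullv F ->
  tnth F' i = \sum_j frame_change F F' i j *: tnth F j.
Proof.
move=> Fb; rewrite {1}(coord_basis_tnth (tnth F' i) Fb).
by apply: eq_bigr => j _; rewrite mxE.
Qed.

(** Orthonormality of both frames makes the matrix orthogonal, so its determinant is 1 or -1, and
    the orientation excludes -1. *)
Lemma frame_change_rotation lam F F' : frame lam F -> frame lam F' ->
  same_orientation F F' ->
  frame_change F F' *m (frame_change F F')^T = 1%:M /\ \det (frame_change F F') = 1.
Proof.
move=> [Fb Fo] [F'b F'o] FF'; set O := frame_change F F'.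
have OO : O *m O^T = 1%:M.
  apply/matrixP => i j; rewrite mxE [RHS]mxE -F'o (frame_changeE F' j Fb).
  rewrite linear_sumr; apply: eq_bigr => k _.
  rewrite linearZr_LR /= su2_ip_sym (frame_changeE F' i Fb).
  by rewrite (orthonormal_coef (B := su2_ip lam)) // mulrC [in LHS]mxE.
split=> //; have /eqP := congr1 determinant OO.
rewrite det_mulmx det_tr det1 -expr2 sqrf_eq1 => /orP[/eqP//|/eqP detO].
by move: FF'; rewrite /same_orientation -/(frame_change F F') -/O detO oppr_gt0 ltr10.
Qed.

Lemma tnth_rot3 (T : Type) (F : 3.-tuple T) (k i : 'I_3) :
  tnth [tuple of rot k F] i = tnth F (i + k).
Proof.
case: F => -[|x [|y [|z [|//]]]] // F3; pose x0 := x; rewrite !(tnth_nth x0).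
by have [] := ord3_cases k => ->; have [] := ord3_cases i => ->;
  rewrite ?add0r ?addr0 ?ord3_add.
Qed.

(** A cyclic permutation of three vectors is even. *)
Lemma frame_rot lam F (k : 'I_3) : frame lam F ->
  frame lam [tuple of rot k F] /\ same_orientation F [tuple of rot k F].
Proof.
move=> [Fb Fo]; split.
  split; last by move=> i j; rewrite !tnth_rot3 Fo (inj_eq (addIr k)).
  by rewrite (perm_basis _ (_ : perm_eq _ F)) // perm_rot.
have coordE (i j : 'I_3) : coord F j (tnth [tuple of rot k F] i) = (i + k == j)%:R.
  by rewrite tnth_rot3 coord_tnth// (basis_free Fb).
rewrite /same_orientation (expand_det_row _ 0) big_ord3 !cofactor3 !mxE !coordE.
by have [] := ord3_cases k => ->; rewrite !ord3_add ?addr0 ?add0r /=; lra.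
Qed.

End SU2Frames.

(** * The components of Pi *)

Lemma linear_linfun (R : realType) (U V W : vectType R) (f : U -> V -> W) :
  (forall x, linear (f x)) -> (forall y, linear (f^~ y)) ->
  linear (fun x => linfun (f x)).
Proof.
move=> fr fl a x y; apply/lfunP => z.
by rewrite add_lfunE scale_lfunE !linfunE// fl.
Qed.

Section Components.
Context {R : realType} {g : vectType R} (br : {bilinear g -> g -> g}).
Local Notation g3 := (g * g * g)%type.
Local Notation M := 'Hom(g, su2 R).
Implicit Types (F : 3.-tuple (su2 R)) (phi : M) (alpha beta : Defs.dual M).

(** The elementary tensor of [x] and [e], when [M] is identified through the Killing form with the
    tensor product of [g] and su(2). *)
Definition rank_one (x : g) (e : su2 R) : M :=
  linfun (fun y => killing br x y *: e).

Lemma rank_oneE x e y : rank_one x e y = killing br x y *: e.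
Proof.
by rewrite linfunE// => a u v; rewrite linearPr /= scalerDl scalerA.
Qed.

Lemma rank_one_linearl e : linear (rank_one^~ e).
Proof.
move=> a x y; apply/lfunP => z; rewrite add_lfunE scale_lfunE !rank_oneE.
by rewrite linearPl /= scalerDl scalerA.
Qed.

Lemma rank_one_linearr x : linear (rank_one x).
Proof.
move=> a e f; apply/lfunP => z; rewrite add_lfunE scale_lfunE !rank_oneE.
by rewrite scalerDr !scalerA mulrC.
Qed.

(* c(e) and xi(e): for a frame they give the i-th components of Psi phi and of
   alpha at e = e_i; see comp3_Psi and covector_comp_Psi_inv. *)
Definition field_comp (lam : R) (phi : M) (e : su2 R) : g :=
  sharp br (linfun (fun x => su2_ip lam e (phi x) : R^o) : Defs.dual g).

Definition covector_coef (alpha : Defs.dual M) (e : su2 R) : g :=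
  sharp br (linfun (fun x => alpha (rank_one x e)) : Defs.dual g).

Lemma field_comp_linear lam phi : linear (field_comp lam phi).
Proof.
move=> a e f; rewrite /field_comp -linearP; congr (sharp br _).
apply: (linear_linfun (f := fun e x => su2_ip lam e (phi x) : R^o)).
  by move=> x b u v; rewrite linearP linearPr.
by move=> x b u v; rewrite linearPl.
Qed.

Lemma covector_coef_linearr alpha : linear (covector_coef alpha).
Proof.
move=> a e f; rewrite /covector_coef -linearP; congr (sharp br _).
apply: (linear_linfun (f := fun e x => alpha (rank_one x e))).
  by move=> x b u v; rewrite rank_one_linearl linearP.
by move=> x b u v; rewrite rank_one_linearr linearP.
Qed.

Lemma covector_coef_linearl e : linear (covector_coef^~ e).
Proof.
move=> a alpha beta; rewrite /covector_coef -linearP; congr (sharp br _).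
apply: (linear_linfun (f := fun alpha x => alpha (rank_one x e))).
  by move=> x b u v; rewrite rank_one_linearl linearP.
by move=> x b u v; rewrite add_lfunE scale_lfunE.
Qed.

Lemma comp3E (p : g3) :
  ((comp3 p 0 = p.1.1) * (comp3 p 1 = p.1.2) * (comp3 p 2 = p.2))%type.
Proof. by rewrite /comp3 !(tnth_nth 0). Qed.

Lemma comp3_inj (p q : g3) : (forall i, comp3 p i = comp3 q i) -> p = q.
Proof.
move: p q => [[a b] c] [[a' b'] c'] pq.
by have := (pq 0, pq 1, pq 2); rewrite !comp3E /= => -[[-> ->] ->].
Qed.

Lemma Psi_inv_incl3 F i x : Psi_inv br F (incl3 i x) = rank_one x (tnth F i).
Proof.
apply/lfunP => y; rewrite rank_oneE Psi_invE big_ord3 !comp3E /=.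
by have [] := ord3_cases i => -> /=; rewrite !linear0l !scale0r ?addr0 ?add0r.
Qed.

Lemma covector_comp_Psi_inv F alpha i :
  covector_comp br (alpha \o Psi_inv br F)%VF i = covector_coef alpha (tnth F i).
Proof.
rewrite /covector_comp /covector_coef; congr (sharp br (linfun _)).
by apply/funext => x; rewrite comp_lfunE Psi_inv_incl3.
Qed.

Hypothesis nd : Defs.nondegenerate br.

Lemma comp3_Psi lam F phi i : frame lam F ->
  comp3 (Psi br F phi) i = field_comp lam phi (tnth F i).
Proof.
move=> [Fb Fo]; rewrite -[LHS](flatK nd); congr (sharp br _); apply/lfunP => x.
rewrite flatE linfunE; last by move=> a u v; rewrite linearP linearPr.
(* Only the [phi] on the right is expanded in the frame; pairing with the [i]-th frame vector then
   extracts the [i]-th coefficient. *)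
rewrite -{2}(PsiK nd Fb phi) Psi_invE.
by rewrite (orthonormal_coef (B := su2_ip lam)).
Qed.

(** Changing the frame multiplies the coordinate triple of [phi] by a rotation, under which [A] is
    invariant. *)
Lemma invariant_frame (A : g3 -> S2 g) lam F F' phi xi eta : SO3_invariant A ->
  frame lam F -> frame lam F' -> same_orientation F F' ->
  A (Psi br F' phi) xi eta = A (Psi br F phi) xi eta.
Proof.
move=> A_inv fF fF' FF'; have [OO detO] := frame_change_rotation fF fF' FF'.
(* [act3] sums over the first index of its matrix, whereas [frame_changeE] sums over the second;
   hence the transpose. *)
rewrite -[RHS](A_inv (frame_change F F')^T); last first.
  by split; rewrite ?det_tr// trmxK mulmx1C.
congr (A _ _ _); apply: comp3_inj => i; rewrite (comp3_Psi _ _ fF').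
rewrite (frame_changeE F' i fF.1) (linear_sumZ _ _ _ (field_comp_linear lam phi)).
have E j : \sum_k (frame_change F F')^T k j *: comp3 (Psi br F phi) k =
    \sum_k frame_change F F' j k *: field_comp lam phi (tnth F k).
  by apply: eq_bigr => k _; rewrite [_^T _ _]mxE (comp3_Psi _ _ fF).
by have [] := ord3_cases i => ->; rewrite comp3E /= E.
Qed.

End Components.

Section Coefficients.
Context {R : realType} {g : vectType R} (br : {bilinear g -> g -> g}).
Hypothesis br_lie : is_lie_bracket br.
Implicit Types (a : {biscalar g}) (xi eta c : 'I_3 -> g).

(* The e_k-component of Pi; k + 1 and k + 2 are taken modulo 3. *)
Definition Pi_coef a xi eta c (k : 'I_3) : R :=
  \sum_j killing br (br (xi k) (eta j)) (c j) +
  \sum_i killing br (br (xi i) (eta k)) (c i) -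
  \sum_i killing br (br (xi i) (eta i)) (c k) +
  (a (xi (k + 1)) (eta (k + 2)) - a (xi (k + 2)) (eta (k + 1))).

Lemma Pi_coef_linearl a b xi xi' eta c k :
  Pi_coef a (fun i => b *: xi i + xi' i) eta c k =
  b * Pi_coef a xi eta c k + Pi_coef a xi' eta c k.
Proof. rewrite /Pi_coef !big_ord3 !linearPl /=; ring. Qed.

(** Skewness of the bracket exchanges the first two sums up to sign and negates the third; symmetry
    of [a] negates the final difference. *)
Lemma Pi_coefC a xi eta c k : (forall x y, a x y = a y x) ->
  Pi_coef a xi eta c k = - Pi_coef a eta xi c k.
Proof.
move=> a_sym; have K i j x : killing br (br (xi i) (eta j)) x =
    - killing br (br (eta j) (xi i)) x.
  by rewrite lie_bracketC// linearNl.
rewrite /Pi_coef !big_ord3 !K !(a_sym (xi _)); ring.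
Qed.

Lemma Pi_coef_rotation a xi eta c (O : 'M[R]_3) k :
  O *m O^T = 1%:M -> \det O = 1 ->
  Pi_coef a (fun i => \sum_j O i j *: xi j) (fun i => \sum_j O i j *: eta j)
    (fun i => \sum_j O i j *: c j) k = \sum_j O k j *: (Pi_coef a xi eta c j : R^o).
Proof.
move=> OO detO; rewrite /Pi_coef.
(* Each of [T1], [T2], [T3] removes the rotation from the contracted pair and holds fixed the vector
   that carries the free index [k]. *)
have T1 x : \sum_j killing br (br x (\sum_l O j l *: eta l)) (\sum_l O j l *: c l)
    = \sum_j killing br (br x (eta j)) (c j).
  apply: (contraction_orthogonal (f := fun y z => killing br (br x y) z : R^o)) => //.
    by move=> z b u v; rewrite linearPr linearPl.
  by move=> y b u v; rewrite linearPr.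
have T2 y : \sum_j killing br (br (\sum_l O j l *: xi l) y) (\sum_l O j l *: c l)
    = \sum_j killing br (br (xi j) y) (c j).
  apply: (contraction_orthogonal (f := fun x z => killing br (br x y) z : R^o)) => //.
    by move=> z b u v; rewrite !linearPl.
  by move=> x b u v; rewrite linearPr.
have T3 z : \sum_j killing br (br (\sum_l O j l *: xi l) (\sum_l O j l *: eta l)) z
    = \sum_j killing br (br (xi j) (eta j)) z.
  apply: (contraction_orthogonal (f := fun x y => killing br (br x y) z : R^o)) => //.
    by move=> y b u v; rewrite !linearPl.
  by move=> x b u v; rewrite linearPr linearPl.
rewrite T1 T2 T3 (skew_part_rotation (f := a : g -> g -> R^o))//; last 2 first.
- by move=> y b u v; rewrite linearPl.
- by move=> x b u v; rewrite linearPr.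
(* What remains of each sum is linear in the vector carrying [k], so row [k] of [O] comes out. *)
have L1 : linear (fun x => \sum_j killing br (br x (eta j)) (c j) : R^o).
  by move=> b u v; rewrite scaler_sumr -big_split; apply: eq_bigr => j _; rewrite !linearPl.
have L2 : linear (fun y => \sum_j killing br (br (xi j) y) (c j) : R^o).
  move=> b u v; rewrite scaler_sumr -big_split; apply: eq_bigr => j _.
  by rewrite linearPr linearPl.
have L3 : linear (fun z => \sum_j killing br (br (xi j) (eta j)) z : R^o).
  move=> b u v; rewrite scaler_sumr -big_split; apply: eq_bigr => j _.
  by rewrite linearPr.
rewrite (linear_sumZ _ _ _ L1) (linear_sumZ _ _ _ L2) (linear_sumZ _ _ _ L3).
rewrite -big_split -sumrB -big_split; apply: eq_bigr => j _ /=.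
by rewrite /GRing.scale /=; ring.
Qed.

End Coefficients.

(** * Frame formula, frame independence and smoothness of [Pi] *)

Section PiFormula.
Context {R : realType} {g : vectType R} (br : {bilinear g -> g -> g}).
Local Notation g3 := (g * g * g)%type.
Local Notation M := 'Hom(g, su2 R).
Hypotheses (br_lie : is_lie_bracket br) (nd : Defs.nondegenerate br).
Variables (lam : R) (A : g3 -> S2 g).
Hypothesis A_inv : SO3_invariant A.
Implicit Types (F : 3.-tuple (su2 R)) (phi : M) (alpha beta : Defs.dual M).

(** The [k]-th summand is computed in the frame rotated by [k], whose [i]-th vector is
    [tnth F (i + k)]; invariance brings the value of [A] back to the point [Psi br F phi]. *)
Lemma PiE F phi alpha beta : frame lam F -> Pi br A F phi alpha beta =
  \sum_k Pi_coef br (A (Psi br F phi))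
    (fun i => covector_coef br alpha (tnth F i))
    (fun i => covector_coef br beta (tnth F i))
    (fun i => field_comp br lam phi (tnth F i)) k *: tnth F k.
Proof.
move=> fF; apply: eq_bigr => k _; congr (_ *: _).
have [fFk FFk] := frame_rot k fF.
rewrite /pi_frame /pi_g3.
under eq_bigr => i _ do under eq_bigr => j _ do rewrite !covector_comp_Psi_inv.
rewrite !big_ord3 /pi_bracket /= !lE.
rewrite !(comp3_Psi nd _ _ fFk) !(invariant_frame nd phi _ _ A_inv fF fFk FFk).
rewrite !tnth_rot3 /Pi_coef !big_ord3.
(* Where all indices equal [k], the three contracted sums contribute 1 + 1 - 1, which is the single
   bracket of [l 0] with itself. *)
by have [] := ord3_cases k => ->; rewrite !ord3_add ?addr0 ?add0r; ring.
Qed.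

(** The components and the frame vectors are rotated by the same [O], and the sum over [k] contracts
    them with each other. *)
Lemma Pi_frame_independent F F' : frame lam F -> frame lam F' ->
  same_orientation F F' -> Pi br A F = Pi br A F'.
Proof.
move=> fF fF' FF'; apply/funext => phi; apply/funext => alpha; apply/funext => beta.
have [OO detO] := frame_change_rotation fF fF' FF'.
rewrite !PiE//; set O := frame_change F F' in OO detO *.
have aE : A (Psi br F' phi) = A (Psi br F phi) :> (g -> g -> R).
  apply/funext => x; apply/funext => y.
  exact: (invariant_frame nd phi x y A_inv fF fF' FF').
have change (h : su2 R -> g) : linear h ->
    (fun i => h (tnth F' i)) = (fun i => \sum_j O i j *: h (tnth F j)).
  move=> h_lin; apply/funext => i; rewrite -(linear_sumZ _ _ _ h_lin).
  by rewrite -frame_changeE// fF.1.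
rewrite (change _ (covector_coef_linearr br alpha)).
rewrite (change _ (covector_coef_linearr br beta)).
rewrite (change _ (field_comp_linear br lam phi)).
(* Scalar multiplication serves as the bilinear map: the sum over [F] becomes a sum of rotated
   components times the vectors of [F']. *)
rewrite -(contraction_orthogonal (f := fun (x : R^o) e => x *: e) _ _ _ _ OO).
- apply: eq_bigr => k _; rewrite -(frame_changeE F' k fF.1); congr (_ *: _).
  rewrite -(Pi_coef_rotation br _ _ _ _ _ OO detO).
  by rewrite /Pi_coef aE.
- by move=> e b x y; rewrite scalerDl scalerA.
- by move=> x b e f; rewrite scalerDr !scalerA mulrC.
Qed.

(** Antisymmetry transfers linearity from the first covector to the second and, 2 being invertible,
    gives alternation. For fixed covectors the bracket terms are linear in the point, so smoothness
    comes down to the terms in [A]. *)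
Lemma Pi_smooth_section F : (forall xi eta, smooth (fun p => A p xi eta : R^o)) ->
  frame lam F -> is_smooth_section (Pi br A F).
Proof.
move=> A_smooth fF.
have linl phi beta : linear (fun alpha => Pi br A F phi alpha beta).
  move=> b alpha alpha'; rewrite !PiE// scaler_sumr -big_split; apply: eq_bigr => k _.
  rewrite /= scalerA -scalerDl -Pi_coef_linearl; congr (_ *: _).
  rewrite (_ : (fun i => covector_coef br (b *: alpha + alpha') (tnth F i)) =
    fun i => b *: covector_coef br alpha (tnth F i) +
      covector_coef br alpha' (tnth F i)) //.
  by apply/funext => i; rewrite covector_coef_linearl.
have PiC phi alpha beta : Pi br A F phi alpha beta = - Pi br A F phi beta alpha.
  rewrite !PiE// -sumrN; apply: eq_bigr => k _.
  by rewrite Pi_coefC ?scaleNr//; apply: S2_sym.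
split=> //.
- move=> phi alpha b beta beta'; rewrite !(PiC phi alpha) linl.
  by rewrite scalerN opprD.
- move=> phi alpha; have /eqP := PiC phi alpha alpha.
  by rewrite -addr_eq0 -mulr2n -scaler_nat scaler_eq0 pnatr_eq0 => /eqP.
move=> alpha beta; pose x i := covector_coef br alpha (tnth F i).
pose y i := covector_coef br beta (tnth F i).
(* [T] collects the bracket terms as a function of the coordinate triple. *)
pose T (p : g3) := \sum_k
  (\sum_j killing br (br (x k) (y j)) (comp3 p j) +
   \sum_i killing br (br (x i) (y k)) (comp3 p i) -
   \sum_i killing br (br (x i) (y i)) (comp3 p k)) *: tnth F k.
have T_lin : linear T.
  move=> b p q; rewrite /T scaler_sumr -big_split; apply: eq_bigr => k _ /=.
  rewrite scalerA -scalerDl; congr (_ *: _); rewrite !big_ord3 !comp3_linear.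
  by rewrite !linearPr /=; ring.
(* This is [A] between two linear maps, [Psi br F] before it and scaling of [e] after it. *)
have A_smooth_comp u v e : smooth (fun phi => A (Psi br F phi) u v *: e).
  have lin_e : linear (fun r : R^o => r *: e).
    by move=> b r s; rewrite scalerDl scalerA.
  rewrite (_ : (fun phi => _) = linfun (fun r : R^o => r *: e) \o
    (fun p => A p u v : R^o) \o Psi br F); first exact: smooth_comp_linear.
  by apply/funext => phi; rewrite /= linfunE.
(* The minus sign is put on [tnth F k] so that both terms in [A] have the form of
   [A_smooth_comp]. *)
rewrite (_ : (fun phi => _) = (linfun T \o Psi br F) \+ (fun phi => \sum_k
    (A (Psi br F phi) (x (k + 1)) (y (k + 2)) *: tnth F k +
     A (Psi br F phi) (x (k + 2)) (y (k + 1)) *: - tnth F k))).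
  apply: smoothD; first exact: smooth_linear.
  by apply: smooth_sum => k; apply: smoothD.
apply/funext => phi; rewrite PiE//= linfunE// -big_split; apply: eq_bigr => k _.
rewrite /= scalerN -scaleNr -!scalerDl; congr (_ *: _); rewrite /Pi_coef.
by rewrite !big_ord3 !(comp3_Psi nd _ _ fF).
Qed.

End PiFormula.

Theorem theorem3p5 (R : realType) (g : vectType R)
    (br : {bilinear g -> g -> g}) (br_lie : is_lie_bracket br)
    (br_compact : compact_lie br) (br_semisimple : semisimple_lie br)
    (lam : R) (lam_pos : forall X : su2 R, X != 0 -> 0 < su2_ip lam X X)
    (A : g * g * g -> S2 g)
    (A_smooth : forall xi eta, smooth (fun p => A p xi eta : R^o))
    (A_inv : SO3_invariant A) :
  (forall F F' : 3.-tuple (su2 R), frame lam F -> frame lam F' ->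
     same_orientation F F' -> Pi br A F = Pi br A F') /\
  (forall B : 3.-tuple (su2 R), basis_of {:su2 R} B ->
     exists! P : bivector_field 'Hom(g, su2 R) (su2 R),
       is_smooth_section P /\
       forall F, frame lam F -> same_orientation B F -> Pi br A F = P).
Proof.
have nd := killing_nondegenerate br_lie br_compact br_semisimple.
have indep F F' := @Pi_frame_independent R g br nd lam A A_inv F F'.
(* The basis [B] stands for an orientation. The witness is [Pi] at one frame [F] so oriented; any
   competing [P] equals it by its own property at [F]. *)
split=> // B Bb; have [F [fF BF]] := frame_exists lam_pos Bb.
exists (Pi br A F); split=> [|P [_ PF]]; last exact: PF.
split=> [|F' fF' BF'].
  exact: (Pi_smooth_section br_lie nd A_inv A_smooth fF).
exact: (esym (indep _ _ fF fF' (same_orientation_trans fF.1 BF BF'))).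
Qed.
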